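(* Let $(X,\mathcal F,\mu)$ be a $\sigma$-finite measure space, let $M_u$ be a positive multiplication operator on $L^2(\mu)$, let $C_\varphi$ be a composition operator on $L^2(\mu)$, and define the weighted composition operator $W=M_uC_\varphi$ on $L^2(\mu)$. Then the following are equivalent: (i) $C_\varphi$ is $M_u$-selfadjoint on $L^2(\mu)$; (ii) $M_uC_\varphi=C_\varphi^*M_u$; (iii) $W$ is selfadjoint, i.e. $W^*=W$.
   Context: $L^2(\mu)$ is the Hilbert space of square-integrable complex-valued functions on $X$ (modulo a.e. equality), with its usual inner product. A positive multiplication operator is $M_uf=u\cdot f$ where $u$ is an essentially bounded measurable function with $u\ge 0$ a.e. A measurable map $\varphi:X\to X$ is non-singular if $\mu\circ\varphi^{-1}$ is absolutely continuous with respect to $\mu$; $\varphi$ is assumed non-singular, and the composition operator is $C_\varphi f=f\circ\varphi$, assumed bounded on $L^2(\mu)$. $W$ acts by $Wf=u\cdot(f\circ\varphi)$. For a positive bounded operator $A$, put $\langle f,g\rangle_A=\langle Af,g\rangle$. A bounded operator $T$ is $A$-selfadjoint if $\langle Tf,g\rangle_A=\langle f,Tg\rangle_A$ for all $f,g$. *)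

(* Defs.v *)
From HB Require Import structures.
From mathcomp Require Import all_boot all_order all_algebra.
From mathcomp Require Import complex.
From mathcomp Require Import all_classical all_reals all_analysis.

Set Implicit Arguments.
Unset Strict Implicit.
Unset Printing Implicit Defensive.

Import Order.TTheory GRing.Theory Num.Theory.
Import numFieldNormedType.Exports.

Local Open Scope classical_set_scope.
Local Open Scope ring_scope.
Local Open Scope complex_scope.

Notation cmodulus := (@ComplexField.Normc.normc _).

Section ComplexL2.
Context d (T : measurableType d) (R : realType).
Variable mu : {measure set T -> \bar R}.
Implicit Types (f g u : T -> R[i]) (phi : T -> T).

(* [R[i]] carries no sigma-algebra in the library; componentwise measurability
   is Borel measurability for R[i] identified with R x R. *)
Definition cmeasurable f : Prop :=
  measurable_fun setT (fun x => complex.Re (f x)) /\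
  measurable_fun setT (fun x => complex.Im (f x)).

Definition cnorm (p : \bar R) f : \bar R := 'N[mu]_p [EFin \o cmodulus \o f].

Definition cLfun (p : \bar R) : set (T -> R[i]) :=
  [set f | cmeasurable f /\ (cnorm p f < +oo)%E].

Definition cintegral f : R[i] :=
  (\int[mu]_x complex.Re (f x)) +i* (\int[mu]_x complex.Im (f x)).

Definition L2fun : Type := set_type (cLfun 2%:E).
HB.instance Definition _ := Choice.on L2fun.

Definition L2fun_val (f : L2fun) : T -> R[i] := \val f.
Coercion L2fun_val : L2fun >-> Funclass.

Definition ae_eq2 (f g : L2fun) : bool := `[< {ae mu, forall x, f x = g x} >].

Lemma ae_eq2_refl : reflexive ae_eq2.
Proof. by move=> f; apply/asboolP; exact: nearW. Qed.

Lemma ae_eq2_sym : symmetric ae_eq2.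
Proof.
by move=> f g; apply/asboolP/asboolP; apply: filterS => x ->.
Qed.

Lemma ae_eq2_trans : transitive ae_eq2.
Proof.
move=> g f h /asboolP fg /asboolP gh; apply/asboolP.
by apply: filterS2 fg gh => x ->.
Qed.

Canonical ae_eq2_equiv := EquivRel ae_eq2 ae_eq2_refl ae_eq2_sym ae_eq2_trans.

Definition L2 : Type := {eq_quot ae_eq2}%qT.
HB.instance Definition _ := Choice.on L2.
HB.instance Definition _ := EqQuotient.on L2.

Definition L2_repr (f : L2) : T -> R[i] := (repr f : L2fun).
Coercion L2_repr : L2 >-> Funclass.

Lemma cLfun2_0 : cLfun 2%:E (cst 0).
Proof.
split; first by split; exact: measurable_cst.
rewrite /cnorm (_ : _ \o _ = cst 0%E) ?Lnorm0 ?pnatr_eq0//.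
by apply/funext => x; congr EFin; exact: ComplexField.Normc.normc0.
Qed.

Definition L2fun0 : L2fun := SigSub (mem_set cLfun2_0).

(* The class of [f]; it is the zero class when [f] is not square-integrable. *)
Definition toL2 f : L2 := \pi_(L2)%qT (insubd L2fun0 f).

Definition inner (f g : L2) : R[i] := cintegral (fun x => f x * conjc (g x)).

Definition is_adjoint (A B : L2 -> L2) : Prop :=
  forall (f g : L2), inner (A f) g = inner f (B g).

(* A map [B] with [is_adjoint A B] is unique, and it exists whenever [A] is a
   bounded operator; for other [A] the value [id] is irrelevant. *)
Definition adjoint (A : L2 -> L2) : L2 -> L2 := xget (id : L2 -> L2) [set B | is_adjoint A B].

Definition inner_wrt (A : L2 -> L2) (f g : L2) : R[i] := inner (A f) g.

Definition selfadjoint_wrt (A S : L2 -> L2) : Prop :=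
  forall (f g : L2), inner_wrt A (S f) g = inner_wrt A f (S g).

Definition mult_op u : L2 -> L2 := fun f : L2 => toL2 (fun x => u x * f x).

Definition comp_op phi : L2 -> L2 := fun f : L2 => toL2 (f \o phi).

Definition nonsingular phi : Prop :=
  measurable_fun setT phi /\ pushforward mu phi `<< mu.

(* The bound makes [f \o phi] square-integrable, so that the default value in
   [toL2] is never taken by [comp_op phi]. *)
Definition comp_bounded phi : Prop :=
  exists K : R, forall f, cLfun 2%:E f ->
    (cnorm 2%:E (f \o phi) <= K%:E * cnorm 2%:E f)%E.

End ComplexL2.

Arguments mult_op {d T R} mu u.
Arguments comp_op {d T R} mu phi.

(* Main.v *)
Require Import Defs.
From HB Require Import structures.
From mathcomp Require Import all_boot all_order all_algebra.
From mathcomp Require Import complex ring lra.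
From mathcomp Require Import all_classical all_reals all_analysis.
From mathcomp Require Import measurable_realfun ess_sup_inf.
Import Order.TTheory GRing.Theory Num.Theory.
Local Open Scope classical_set_scope.
Local Open Scope ring_scope.
Local Open Scope complex_scope.

(** Write [M] and [C] for multiplication by [u] and composition with [phi].
Once [C] has a genuine adjoint [S], the three conditions are one identity
between sesquilinear forms.  Since [u] is real almost everywhere, [M] is its
own adjoint ([mult_op_sym]), so [S \o M] is an adjoint of [W = M \o C], and
adjoints are unique because the inner product separates the points of L2
([inner_inj], [adjoint_eq]).  Hence [adjoint W = W] says literally that
[S \o M = M \o C].  On the other side <MCf, g> = <Mf, Cg> for all [f], [g]
means <MCf, g> = <SMf, g>, which is the same equation of operators.

The substance is the existence of [S] ([comp_op_adjoint]).  It is obtained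
from the Radon-Nikodym theorem rather than from completeness of L2.  For a
nonnegative [a] in real L2, one wants [b] in L2 with
<h o phi, a> = <h, b>, so [b] has to be the density of the measure sending [A]
to the integral of [a] over [phi @^-1` A].  That measure may be infinite, so
fix a strictly positive [w] in L2, namely the square root of a strictly
positive integrable function, which exists by sigma-finiteness
([sigma_finite_pos_integrable]).  The measure with density [(w o phi) * a] is
finite, its image under [phi] is absolutely continuous because [phi] is
non-singular, and if [g] is its density then [b = g / w] works against every
nonnegative measurable [h] ([comp_density_transpose]).

That [b] is square-integrable is where boundedness of [C] enters: testing the
identity on the truncations [h_n = min (b, n * w)], which are in L2, gives
|h_n|^2 <= <h_n, b> = <h_n o phi, a>, and boundedness of [C] turns this into a
bound on |h_n| that does not depend on [n]; monotone convergence finishes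
([comp_transpose_ge0]).  Signed [a] and [h] follow by splitting into positive
and negative parts ([comp_transpose]), and the complex case by splitting into
real and imaginary parts ([cdotE]). *)

Set Implicit Arguments.
Unset Strict Implicit.
Unset Printing Implicit Defensive.

(** * Real square-integrable functions *)

Section real_L2.
Context d (T : measurableType d) (R : realType).
Variable mu : {measure set T -> \bar R}.
Implicit Types a b f g : T -> R.

Lemma powR_norm2 (x : R) : `|x| `^ 2%R = x ^+ 2.
Proof. by rewrite powR_mulrn// real_normK// num_real. Qed.

Lemma Lfun2P f : f \in Lfun mu 2%:E <->
  measurable_fun setT f /\ (\int[mu]_x (f x ^+ 2)%:E < +oo)%E.
Proof.
have N2 : (forall h : T -> R, 'N[mu]_2%:E[EFin \o h] `^ 2 = \int[mu]_x (h x ^+ 2)%:E)%E.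
  by move=> h; rewrite poweR_Lnorm//; apply: eq_integral => x _ /=; rewrite powR_norm2.
split.
  rewrite inE => /andP[]; rewrite !inE /= => mf ff; split => //.
  by rewrite -N2; exact: poweR_lty.
move=> [mf]; rewrite -N2 => ff; rewrite inE/=; apply/andP; split; rewrite inE//=.
exact: lty_poweRy ff.
Qed.

Lemma Lfun2_meas f : f \in Lfun mu 2%:E -> measurable_fun setT f.
Proof. by move/Lfun2P => -[]. Qed.

Lemma Lfun2_le f g : measurable_fun setT f -> (forall x, f x ^+ 2 <= g x ^+ 2) ->
  g \in Lfun mu 2%:E -> f \in Lfun mu 2%:E.
Proof.
move=> mf fg /Lfun2P[mg gfin]; apply/Lfun2P; split => //.
apply: le_lt_trans gfin; apply: ge0_le_integral => //.
- by move=> x _; rewrite lee_fin sqr_ge0.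
- by apply/measurable_EFinP; exact: measurable_funX.
- by apply/measurable_EFinP; exact: measurable_funX.
- by move=> x _; rewrite lee_fin.
Qed.

Lemma Lfun2D f g : f \in Lfun mu 2%:E -> g \in Lfun mu 2%:E ->
  f \+ g \in Lfun mu 2%:E.
Proof. by have [_ +] := Lfun_addr_closed mu (lee1n 2); apply. Qed.

Lemma Lfun2N f : f \in Lfun mu 2%:E -> \- f \in Lfun mu 2%:E.
Proof. by move=> hf; rewrite (Lfun_oppr_closed hf). Qed.

Lemma Lfun2B f g : f \in Lfun mu 2%:E -> g \in Lfun mu 2%:E ->
  f \- g \in Lfun mu 2%:E.
Proof. by move=> hf hg; apply: Lfun2D => //; exact: Lfun2N. Qed.

Lemma Lfun2_mul_integrable f g : f \in Lfun mu 2%:E -> g \in Lfun mu 2%:E ->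
  mu.-integrable setT (EFin \o (fun x => f x * g x)).
Proof. by move=> hf hg; apply/Lfun1_integrable; exact: Lfun2_mul_Lfun1. Qed.

Definition rdot f g : R := \int[mu]_x (f x * g x).

Lemma rdotC f g : rdot f g = rdot g f.
Proof. by apply: eq_Rintegral => x _; rewrite mulrC. Qed.

Lemma rdotBl f g h : f \in Lfun mu 2%:E -> g \in Lfun mu 2%:E ->
  h \in Lfun mu 2%:E -> rdot (f \- g) h = rdot f h - rdot g h.
Proof.
move=> hf hg hh; rewrite /rdot -RintegralB//; [|exact: Lfun2_mul_integrable..].
by apply: eq_Rintegral => x _; rewrite mulrBl.
Qed.

Lemma rdotBr f g h : f \in Lfun mu 2%:E -> g \in Lfun mu 2%:E ->
  h \in Lfun mu 2%:E -> rdot h (f \- g) = rdot h f - rdot h g.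
Proof. by move=> hf hg hh; rewrite !(rdotC h) rdotBl. Qed.

Lemma rdot_sq_ge0 f : 0 <= rdot f f.
Proof. by apply: Rintegral_ge0 => x _; rewrite -expr2 sqr_ge0. Qed.

Lemma rdot_sq_eq0 f : f \in Lfun mu 2%:E -> rdot f f = 0 ->
  {ae mu, forall x, f x = 0}.
Proof.
move=> hf f0; have [mf ff] := (Lfun2P f).1 hf.
have f2E : (\int[mu]_x (f x * f x)%:E = \int[mu]_x (f x ^+ 2)%:E)%E.
  by apply: eq_integral => x _; rewrite expr2.
have : (\int[mu]_x `|(f x ^+ 2)%:E| = 0)%E.
  rewrite (eq_integral (fun x => (f x ^+ 2)%:E)); last first.
    by move=> x _; rewrite gee0_abs ?lee_fin ?sqr_ge0.
  rewrite -[LHS]fineK; first by rewrite -f2E; congr EFin.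
  rewrite ge0_fin_numE//.
  by apply: integral_ge0 => x _; rewrite lee_fin sqr_ge0.
have mf2 : measurable_fun setT (fun x => (f x ^+ 2)%:E).
  by apply/measurable_EFinP; exact: measurable_funX.
move/(ae_eq_integral_abs mu measurableT mf2).
apply: filterS => x /(_ I) [] /eqP; rewrite sqrf_eq0 => /eqP; exact.
Qed.

Lemma Lfun2_funrpos f : f \in Lfun mu 2%:E -> f^\+ \in Lfun mu 2%:E.
Proof.
move=> hf; apply: (Lfun2_le _ _ hf).
  by apply: measurable_funrpos; exact: Lfun2_meas hf.
move=> x; rewrite /funrpos -(real_normK (num_real (f x))) ler_sqr ?nnegrE ?le_max ?lexx ?orbT//.
by rewrite ge_max ler_norm/=.
Qed.

Lemma Lfun2_funrneg f : f \in Lfun mu 2%:E -> f^\- \in Lfun mu 2%:E.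
Proof.
move=> hf; rewrite -funrposN; apply: Lfun2_funrpos; exact: Lfun2N.
Qed.

Lemma funrB f : f = f^\+ \- f^\-.
Proof. by rewrite -[LHS]funrposBneg. Qed.

End real_L2.

(** * Transposing a composition by the Radon-Nikodym theorem *)

(** Weigh a countable cover [F n] of finite measure by [2^-(n+1) / (1 + mu (F n))]:
the sum is positive because the [F n] cover the space, finite everywhere
because the weights are summable, and its integral is at most 1. *)
Lemma sigma_finite_pos_integrable d (T : measurableType d) (R : realType)
    (mu : {sigma_finite_measure set T -> \bar R}) :
  exists k : T -> R, [/\ measurable_fun setT k, forall x, 0 < k x &
    (\int[mu]_x (k x)%:E < +oo)%E].
Proof.
have [F FT mF] := sigma_finiteT mu.
pose e n : R := (1 / (2 ^ n.+1)%:R).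
have e0 n : 0 < e n by rewrite divr_gt0// ltr0n expn_gt0.
have se : (\sum_(0 <= n <oo) (e n)%:E <= 1%:E)%E.
  have := @epsilon_trick R (fun=> 0%E) 1 xpredT (fun=> lexx _) ler01.
  rewrite [X in (_ <= X + _)%E]eseries0// add0e; apply: le_trans.
  apply: lee_nneseries => [n _ _|n _]; first by rewrite lee_fin ltW.
  by rewrite add0e.
pose m n := fine (mu (F n)).
have m0 n : 0 <= m n by rewrite fine_ge0.
have m1 n : 0 < 1 + m n by rewrite ltr_pwDl.
pose c n : R := e n / (1 + m n).
have c0 n : 0 < c n by rewrite divr_gt0.
pose s x : \bar R := (\sum_(0 <= n <oo) (c n * \1_(F n) x)%:E)%E.
have t0 n x : (0 <= (c n * \1_(F n) x)%:E)%E.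
  by rewrite lee_fin mulr_ge0// ltW.
have ms : measurable_fun setT s.
  apply: ge0_emeasurable_sum => // n _.
  by apply/measurable_EFinP; apply: measurable_funM => //; exact: measurable_indic (mF n).1.
have s0 x : (0 <= s x)%E by apply: nneseries_ge0.
have sfin x : s x \is a fin_num.
  rewrite ge0_fin_numE//; apply: (@le_lt_trans _ _ 1%:E); last exact: ltry.
  apply: le_trans se; apply: lee_nneseries => // n _; rewrite lee_fin.
  rewrite -[leRHS]mulr1; apply: ler_pM => //; first exact: ltW.
    by rewrite ler_pdivrMr// ler_peMr ?lerDl// ltW.
exists (fine \o s); split.
- exact: measurableT_comp.
- move=> x; apply: fine_gt0; rewrite -ge0_fin_numE// sfin andbT.
  have [n _ Fnx] : (\bigcup_i F i) x by rewrite -FT.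
  rewrite (@lt_le_trans _ _ (c n)%:E)// ?lte_fin//.
  apply: le_trans (nneseries_lim_ge n.+1 _) => //.
  rewrite big_nat_recr//= indicE mem_set// mulr1.
  by rewrite leeDr// sume_ge0.
- under eq_integral do rewrite /= fineK//.
  rewrite integral_nneseries//.
    apply: le_lt_trans (ltry 1); apply: le_trans se; apply: lee_nneseries => [n _ _|n _].
      by apply: integral_ge0.
    under eq_integral do rewrite EFinM.
    rewrite ge0_integralZl//; last 2 first.
    + by apply/measurable_EFinP; exact: measurable_indic (mF n).1.
    + by rewrite lee_fin ltW.
    rewrite integral_indic ?setIT//; last exact: (mF n).1.
    rewrite -[X in (_ * X)%E]fineK ?ge0_fin_numE ?(mF n).2//.
    rewrite -EFinM lee_fin -/(m n) /c mulrAC ler_pdivrMr// ler_pM2l//.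
    by rewrite lerDr.
  by move=> n; apply/measurable_EFinP; apply: measurable_funM => //; exact: measurable_indic (mF n).1.
Qed.

Lemma exists_density_measure d (T : measurableType d) (R : realType)
    (mu : {measure set T -> \bar R}) (k : T -> \bar R) :
  (forall x, 0 <= k x)%E -> mu.-integrable setT k ->
  exists m : {finite_measure set T -> \bar R},
    forall A, m A = (\int[mu]_(x in A) k x)%E.
Proof.
move=> k0 ik.
have i0 A : (0 <= induced_charge ik A)%E by exact: integral_ge0.
pose m0 := measure_of_charge (induced_charge ik) i0.
have fin0 : fin_num_fun m0 by move=> A mA; rewrite fin_num_measure.
pose mix := @Measure_isFinite.Build _ _ _ m0 fin0.
pose m : {finite_measure set T -> \bar R} := HB.pack m0 mix.
by exists m.
Qed.

Lemma exists_pushforward_measure d (T : measurableType d) (R : realType)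
    (m : {finite_measure set T -> \bar R}) (phi : T -> T) :
  measurable_fun setT phi ->
  exists m' : {finite_measure set T -> \bar R},
    m' = pushforward m phi :> (set T -> \bar R).
Proof.
move=> mphi.
have mpre A : measurable A -> measurable (phi @^-1` A).
  by move=> mA; rewrite -[X in measurable X]setTI; exact: mphi.
(* The measure structure on a pushforward depends on a proof of measurability,
   which inference cannot supply, hence the explicit instance. *)
pose m0 := measure_function_pushforward__canonical__measure_function_Measure m mphi.
have fin0 : fin_num_fun m0.
  by move=> A mA; apply: fin_num_measure; exact: mpre.
pose mix := @Measure_isFinite.Build _ _ _ m0 fin0.
pose m' : {finite_measure set T -> \bar R} := HB.pack (pushforward m phi : set T -> \bar R) (Measure.class m0) mix.
by exists m'.
Qed.

(** The Radon-Nikodym derivative of [m] agrees almost everywhere with the given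
density [k], so its change-of-variables formula holds for [k] too. *)
Lemma integral_density d (T : measurableType d) (R : realType)
    (mu : {sigma_finite_measure set T -> \bar R})
    (m : {finite_measure set T -> \bar R}) (k : T -> \bar R) :
  (forall x, 0 <= k x)%E -> mu.-integrable setT k ->
  (forall A, measurable A -> m A = (\int[mu]_(x in A) k x)%E) ->
  m `<< mu /\
  forall f : T -> \bar R, (forall x, 0 <= f x)%E -> measurable_fun setT f ->
    (\int[m]_x f x = \int[mu]_x (f x * k x))%E.
Proof.
move=> k0 ik mE.
have mk : measurable_fun setT k := measurable_int _ ik.
have m_mu : m `<< mu.
  apply/null_content_dominatesP => A mA muA; rewrite mE//.
  by apply: null_set_integral => //; exact: measurable_funTS.
split=> // f f0 mf.
have irn := Radon_Nikodym_SigmaFinite.f_integrable m_mu.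
rewrite -(Radon_Nikodym_SigmaFinite.change_of_variables m_mu)//.
apply: ae_eq_integral => //.
- by apply: emeasurable_funM => //; exact: measurable_int irn.
- exact: emeasurable_funM.
have : ae_eq mu setT (Radon_Nikodym_SigmaFinite.f m mu) k.
  apply: integral_ae_eq => //.
  by move=> E _ mE'; rewrite -Radon_Nikodym_SigmaFinite.f_integral// mE.
by apply: filterS => x /= + _ => ->.
Qed.

(** [g] is the density of the image under [phi] of the measure with density [k];
integrability of [k] makes that image finite, and non-singularity of [phi] makes
it absolutely continuous. *)
Lemma comp_density_transpose d (T : measurableType d) (R : realType)
    (mu : {sigma_finite_measure set T -> \bar R}) (phi : T -> T) (k : T -> R) :
  nonsingular mu phi -> (forall x, 0 <= k x) -> mu.-integrable setT (EFin \o k) ->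
  exists g : T -> R, [/\ measurable_fun setT g, forall x, 0 <= g x &
    forall h : T -> R, measurable_fun setT h -> (forall x, 0 <= h x) ->
      (\int[mu]_x (h x * g x)%:E = \int[mu]_x (h (phi x) * k x)%:E)%E].
Proof.
move=> [mphi nsphi] k0 ik.
have ek0 x : (0 <= (EFin \o k) x)%E by rewrite lee_fin.
have [m mE] := exists_density_measure ek0 ik.
have [m_mu mint] := integral_density ek0 ik (fun A _ => mE A).
have [m' m'E] := exists_pushforward_measure m mphi.
have m'_mu : m' `<< mu.
  apply/null_content_dominatesP => A mA muA; rewrite m'E.
  have mpA : measurable (phi @^-1` A) by rewrite -[X in measurable X]setTI; exact: mphi.
  move/null_content_dominatesP : m_mu; apply => //.
  by move/null_content_dominatesP : nsphi; apply.
have rn0 := Radon_Nikodym_SigmaFinite.f_ge0 m'_mu.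
have rnfin := Radon_Nikodym_SigmaFinite.f_fin_num m'_mu.
have irn := Radon_Nikodym_SigmaFinite.f_integrable m'_mu.
exists (fine \o Radon_Nikodym_SigmaFinite.f m' mu); split.
- by apply: measurableT_comp => //; exact: measurable_int irn.
- by move=> x; exact: fine_ge0.
move=> h mh h0.
have mEh : measurable_fun setT (EFin \o h) by exact/measurable_EFinP.
transitivity (\int[m']_x (h x)%:E)%E.
  rewrite -(Radon_Nikodym_SigmaFinite.change_of_variables m'_mu)//.
  by apply: eq_integral => x _ /=; rewrite EFinM fineK.
rewrite m'E ge0_integral_pushforward//; last by move=> x _; rewrite lee_fin.
rewrite -[LHS]/(\int[m]_x (h (phi x))%:E)%E mint => [||].
- by apply: eq_integral => x _; rewrite EFinM.
- by move=> x; rewrite lee_fin.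
- by apply/measurable_EFinP; exact: measurableT_comp.
Qed.

(** Boundedness of the composition operator on real L2, with squared norms so
that no square root of an extended real occurs; [c] is the square of an operator
bound. *)
Definition sq_comp_bounded d (T : measurableType d) (R : realType)
    (mu : {measure set T -> \bar R}) (phi : T -> T) (c : R) :=
  forall f : T -> R, f \in Lfun mu 2%:E ->
    (\int[mu]_x (f (phi x) ^+ 2)%:E <= c%:E * \int[mu]_x (f x ^+ 2)%:E)%E.

Section transpose.
Context d (T : measurableType d) (R : realType).
Variables (mu : {sigma_finite_measure set T -> \bar R}) (phi : T -> T) (c : R).
Hypotheses (nsphi : nonsingular mu phi) (c0 : 0 < c)
  (phic : sq_comp_bounded mu phi c).

Lemma Lfun2_comp (f : T -> R) : f \in Lfun mu 2%:E -> f \o phi \in Lfun mu 2%:E.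
Proof using nsphi c0 phic.
move=> hf; have /Lfun2P[mf ff] := hf; apply/Lfun2P; split.
  by apply: measurableT_comp => //; exact: nsphi.1.
apply: le_lt_trans (phic hf) _.
by rewrite lte_mul_pinfty// lee_fin ltW.
Qed.

(** The identity is required for all nonnegative measurable [h], with values in
the extended reals: the proof that [b] is in L2 uses it before [h * b] is known to
be integrable. *)
Lemma comp_transpose_ge0 (a : T -> R) : a \in Lfun mu 2%:E -> (forall x, 0 <= a x) ->
  exists b : T -> R, b \in Lfun mu 2%:E /\
    forall h : T -> R, measurable_fun setT h -> (forall x, 0 <= h x) ->
    (\int[mu]_x (h (phi x) * a x)%:E = \int[mu]_x (h x * b x)%:E)%E.
Proof using nsphi c0 phic.
move=> ha a0.
have [k [mk k0 ik]] := sigma_finite_pos_integrable mu.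
(* The weight [w] makes [(w \o phi) * a] integrable; it is divided out below. *)
pose w x := k x `^ (2^-1).
have w0 x : 0 < w x by rewrite powR_gt0.
have mw : measurable_fun setT w.
  by apply: (@measurableT_comp _ _ _ _ _ _ (@powR R ^~ _)) => //; exact: measurable_powR.
have hw : w \in Lfun mu 2%:E.
  apply/Lfun2P; split => //; apply: le_lt_trans ik.
  rewrite le_eqVlt; apply/orP; left; apply/eqP; apply: eq_integral => x _.
  by rewrite /w powR12_sqrt ?sqr_sqrtr// ltW.
have hwphi := Lfun2_comp hw.
have wa0 x : 0 <= w (phi x) * a x by rewrite mulr_ge0// ltW.
have [g [mg g0 gE]] := comp_density_transpose nsphi wa0 (Lfun2_mul_integrable hwphi ha).
have mwV : measurable_fun setT (fun x => (w x)^-1).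
  rewrite (_ : (fun _ => _) = (fun x => w x `^ (-1))).
    by apply: (@measurableT_comp _ _ _ _ _ _ (@powR R ^~ _)) => //; exact: measurable_powR.
  by apply/funext => x; rewrite powR_inv1// ltW.
pose b x := (w x)^-1 * g x.
have mb : measurable_fun setT b by exact: measurable_funM.
have b0 x : 0 <= b x by rewrite mulr_ge0// invr_ge0 ltW.
have bE (h : T -> R) : measurable_fun setT h -> (forall x, 0 <= h x) ->
    (\int[mu]_x (h (phi x) * a x)%:E = \int[mu]_x (h x * b x)%:E)%E.
  move=> mh h0; have := gE (fun x => h x * (w x)^-1).
  have -> : (fun x => (h x * (w x)^-1 * g x)%:E) = (fun x => (h x * b x)%:E).
    by apply/funext => x; rewrite mulrA.
  have -> : (fun x => (h (phi x) * (w (phi x))^-1 * (w (phi x) * a x))%:E) =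
            (fun x => (h (phi x) * a x)%:E).
    by apply/funext => x; rewrite mulrA mulfVK// gt_eqF.
  move=> -> //; first exact: measurable_funM.
  by move=> x; rewrite mulr_ge0// invr_ge0 ltW.
exists b; split => //; apply/Lfun2P; split => //.
have /Lfun2P[ma fa] := ha.
(* These truncations lie in L2 thanks to [w] and increase to [b] since [w > 0]. *)
pose h n x := Num.min (b x) (n%:R * w x).
have h0 n x : 0 <= h n x by rewrite le_min b0 mulr_ge0// ltW.
have mh n : measurable_fun setT (h n).
  by apply: measurable_minr => //; exact: measurable_funM.
have hh n : h n \in Lfun mu 2%:E.
  apply: (@Lfun2_le _ _ _ _ _ (n%:R \o* w)) => // [x|].
    by rewrite /= ler_sqr ?nnegrE// ?mulr_ge0// ?(ltW (w0 x))// /h [w x * _]mulrC ge_min lexx orbT.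
  by apply: Lfun_scale => //; rewrite ler1n.
have bound n : (\int[mu]_x (h n x ^+ 2)%:E <= c%:E * \int[mu]_x (a x ^+ 2)%:E)%E.
  have /Lfun2P[mhphi fhphi] := Lfun2_comp (hh n).
  have /Lfun2P[_ fh] := hh n.
  have le1 : (\int[mu]_x (h n x ^+ 2)%:E <= \int[mu]_x (h n (phi x) * a x)%:E)%E.
    rewrite bE//; apply: ge0_le_integral => //.
    + by move=> x _; rewrite lee_fin sqr_ge0.
    + by apply/measurable_EFinP; exact: measurable_funX.
    + by apply/measurable_EFinP; exact: measurable_funM.
    + by move=> x _; rewrite lee_fin expr2 ler_wpM2l// ge_min lexx.
  (* Weighted AM-GM; the weight is chosen so that, once the norm of [h n \o phi] is
     bounded by that of [h n], half of the left-hand side can be absorbed. *)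
  have le2 : (\int[mu]_x (h n (phi x) * a x)%:E <=
     \int[mu]_x ((2 * c)^-1%:E * (h n (phi x) ^+ 2)%:E + (c / 2)%:E * (a x ^+ 2)%:E))%E.
    apply: ge0_le_integral => //.
    + by move=> x _; rewrite lee_fin mulr_ge0.
    + by apply/measurable_EFinP; exact: measurable_funM.
    + apply: emeasurable_funD; apply/measurable_EFinP; apply: measurable_funM => //;
        exact: measurable_funX.
    + move=> x _; rewrite -!EFinM -EFinD lee_fin -subr_ge0.
      rewrite (_ : _ - _ = (2 * c)^-1 * (h n (phi x) - c * a x) ^+ 2).
        by rewrite mulr_ge0 ?sqr_ge0// invr_ge0 mulr_ge0// ltW.
      by field; rewrite gt_eqF.
  move: le2; rewrite ge0_integralD//; first last.
  - by apply/measurable_EFinP; apply: measurable_funM => //; exact: measurable_funX.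
  - by move=> x _; rewrite lee_fin mulr_ge0 ?sqr_ge0 ?divr_ge0// ltW.
  - by apply/measurable_EFinP; apply: measurable_funM => //; exact: measurable_funX.
  - by move=> x _; rewrite lee_fin mulr_ge0 ?sqr_ge0// invr_ge0 mulr_ge0// ltW.
  rewrite ge0_integralZl//; first last.
  - by rewrite lee_fin invr_ge0 mulr_ge0// ltW.
  - by move=> x _; rewrite lee_fin sqr_ge0.
  - by apply/measurable_EFinP; exact: measurable_funX.
  rewrite ge0_integralZl//; first last.
  - by rewrite lee_fin divr_ge0// ltW.
  - by move=> x _; rewrite lee_fin sqr_ge0.
  - by apply/measurable_EFinP; exact: measurable_funX.
  move=> le2; have := le_trans le1 le2 => {le1 le2}.
  have := phic (hh n).
  have nE (q : T -> R) : q \in Lfun mu 2%:E ->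
      exists r, (\int[mu]_x (q x ^+ 2)%:E = r%:E)%E.
    move=> /Lfun2P[_ fq]; exists (fine (\int[mu]_x (q x ^+ 2)%:E)).
    by rewrite fineK// ge0_fin_numE// integral_ge0// => x _; rewrite lee_fin sqr_ge0.
  have [p ->] := nE _ (hh n).
  have [q qE] := nE _ (Lfun2_comp (hh n)); rewrite [X in (X <= _)%E]qE qE.
  have [r ->] := nE _ ha.
  rewrite -!EFinM -EFinD !lee_fin => pq.
  rewrite -(@ler_pM2l _ (2 * c)^-1) ?invr_gt0 ?mulr_gt0// in pq.
  rewrite (_ : _ * (c * p) = p / 2) in pq; last by field; rewrite gt_eqF.
  lra.
have lim_h x : ((h n x ^+ 2)%:E @[n --> \oo] --> (b x ^+ 2)%:E)%E.
  apply: cvg_near_cst; exists (Num.truncn (b x / w x)).+1 => // n /= Nn.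
  rewrite /h min_l// -ler_pdivrMr// ltW//.
  by rewrite (lt_le_trans (truncnS_gt _))// ler_nat.
have -> : (\int[mu]_x (b x ^+ 2)%:E = \int[mu]_x (limn (fun n => (h n x ^+ 2)%:E)))%E.
  by apply: eq_integral => x _; apply/esym/cvg_lim.
apply: (@le_lt_trans _ _ (c%:E * \int[mu]_x (a x ^+ 2)%:E)%E); last first.
  by rewrite lte_mul_pinfty// lee_fin ltW.
have mono : (\int[mu]_x (h n x ^+ 2)%:E @[n --> \oo] -->
    \int[mu]_x (limn (fun n => (h n x ^+ 2)%:E)))%E.
  apply: cvg_monotone_convergence => //.
  - by move=> n; apply/measurable_EFinP; exact: measurable_funX.
  - by move=> n x _; rewrite lee_fin sqr_ge0.
  - move=> x _ n p np; rewrite lee_fin ler_sqr ?nnegrE//.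
    rewrite /h le_min ge_min lexx /= ge_min; apply/orP; right.
    by apply: ler_wpM2r; [exact: ltW|rewrite ler_nat].
rewrite -(cvg_lim _ mono)//; apply: lime_le.
  by apply/cvg_ex; eexists; exact: mono.
exact: nearW.
Qed.

End transpose.

(** Both sides are linear in [a] and in [h], so positive and negative parts can
be treated separately. *)
Lemma comp_transpose d (T : measurableType d) (R : realType)
    (mu : {sigma_finite_measure set T -> \bar R}) (phi : T -> T) (c : R) :
  nonsingular mu phi -> 0 < c -> sq_comp_bounded mu phi c ->
  forall a : T -> R, a \in Lfun mu 2%:E ->
  exists b : T -> R, b \in Lfun mu 2%:E /\
    forall h : T -> R, h \in Lfun mu 2%:E -> rdot mu (h \o phi) a = rdot mu h b.
Proof.
move=> ns c0 phic a ha.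
have [b1 [hb1 b1E]] := comp_transpose_ge0 ns c0 phic (Lfun2_funrpos ha) (funrpos_ge0 a).
have [b2 [hb2 b2E]] := comp_transpose_ge0 ns c0 phic (Lfun2_funrneg ha) (funrneg_ge0 a).
exists (b1 \- b2); split; first exact: Lfun2B.
have pos (h : T -> R) : h \in Lfun mu 2%:E -> (forall x, 0 <= h x) ->
    rdot mu (h \o phi) a = rdot mu h (b1 \- b2).
  move=> hh h0; have hm := Lfun2_meas hh.
  rewrite rdotBr// {1}(funrB a) rdotBr//; first last.
  - exact: (Lfun2_comp ns c0 phic).
  - exact: Lfun2_funrneg.
  - exact: Lfun2_funrpos.
  by rewrite /rdot /Rintegral b1E// b2E.
move=> h hh; have hp := Lfun2_funrpos hh; have hn := Lfun2_funrneg hh.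
rewrite (funrB h) [RHS]rdotBl//; last exact: Lfun2B.
rewrite -[X in rdot _ X _]/((h^\+ \o phi) \- (h^\- \o phi)).
rewrite rdotBl//; [|exact: (Lfun2_comp ns c0 phic)..].
by rewrite !pos.
Qed.

(** * Reduction of complex L2 to real L2 *)

Section complexL2.
Context d (T : measurableType d) (R : realType) (mu : {measure set T -> \bar R}).
Implicit Types f g : T -> R[i].

Definition re_fun f : T -> R := fun x => complex.Re (f x).
Definition im_fun f : T -> R := fun x => complex.Im (f x).

Lemma sqr_cnorm2 f : cmeasurable f -> (cnorm mu 2%:E f `^ 2 =
  \int[mu]_x (re_fun f x ^+ 2)%:E + \int[mu]_x (im_fun f x ^+ 2)%:E)%E.
Proof.
move=> mf; rewrite /cnorm poweR_Lnorm// -ge0_integralD//.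
- apply: eq_integral => x _; rewrite /re_fun /im_fun /=; case: (f x) => a b /=.
  by rewrite powR_norm2 sqr_sqrtr ?addr_ge0 ?sqr_ge0.
- by move=> x _; rewrite lee_fin sqr_ge0.
- by apply/measurable_EFinP; apply: measurable_funX; exact: mf.1.
- by move=> x _; rewrite lee_fin sqr_ge0.
- by apply/measurable_EFinP; apply: measurable_funX; exact: mf.2.
Qed.

Lemma cLfun2P f : cLfun mu 2%:E f <->
  re_fun f \in Lfun mu 2%:E /\ im_fun f \in Lfun mu 2%:E.
Proof.
have I0 (q : T -> R) : (0 <= \int[mu]_x (q x ^+ 2)%:E)%E.
  by apply: integral_ge0 => x _; rewrite lee_fin sqr_ge0.
split.
  move=> [mf ff]; have := poweR_lty 2 ff; rewrite sqr_cnorm2// => fin.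
  split; apply/Lfun2P; split; [exact: mf.1| |exact: mf.2|].
    by apply: le_lt_trans fin; rewrite leeDl.
  by apply: le_lt_trans fin; rewrite leeDr.
move=> [/Lfun2P[m1 f1] /Lfun2P[m2 f2]].
have mf : cmeasurable f by split.
split => //; apply: (@lty_poweRy _ _ 2) => //.
by rewrite sqr_cnorm2// lte_add_pinfty.
Qed.

(** The inner product before passing to classes, so that operators given by
formulas on functions can be moved in and out of [toL2]. *)
Definition cdot f g : R[i] := cintegral mu (fun x => f x * conjc (g x)).

Lemma cdotE f g : cLfun mu 2%:E f -> cLfun mu 2%:E g ->
  cdot f g = (rdot mu (re_fun f) (re_fun g) + rdot mu (im_fun f) (im_fun g)) +i*
             (rdot mu (im_fun f) (re_fun g) - rdot mu (re_fun f) (im_fun g)).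
Proof.
move=> /cLfun2P[rf imf] /cLfun2P[rg img].
rewrite /cdot /cintegral /rdot -RintegralD//; [|exact: Lfun2_mul_integrable..].
rewrite -RintegralB//; [|exact: Lfun2_mul_integrable..].
congr (_ +i* _); apply: eq_Rintegral => x _; rewrite /re_fun /im_fun;
  by case: (f x) (g x) => a b [a' b'] /=; ring.
Qed.

Lemma cdot_ae f g f' g' :
  cmeasurable f -> cmeasurable g -> cmeasurable f' -> cmeasurable g' ->
  {ae mu, forall x, f x * conjc (g x) = f' x * conjc (g' x)} ->
  cdot f g = cdot f' g'.
Proof.
move=> [f1 f2] [g1 g2] [f1' f2'] [g1' g2'] fg.
have mre (p q : T -> R[i]) : measurable_fun setT (re_fun p) -> measurable_fun setT (im_fun p) ->
    measurable_fun setT (re_fun q) -> measurable_fun setT (im_fun q) ->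
    measurable_fun setT (fun x => (complex.Re (p x * conjc (q x)))%:E) /\
    measurable_fun setT (fun x => (complex.Im (p x * conjc (q x)))%:E).
  move=> m1 m2 m3 m4; split; apply/measurable_EFinP.
    rewrite (_ : (fun _ => _) = (re_fun p \* re_fun q) \+ (im_fun p \* im_fun q)).
      by apply: measurable_funD; exact: measurable_funM.
    by apply/funext => x /=; rewrite /re_fun /im_fun; case: (p x) (q x) => a b [? ?] /=; ring.
  rewrite (_ : (fun _ => _) = (im_fun p \* re_fun q) \- (re_fun p \* im_fun q)).
    by apply: measurable_funB; exact: measurable_funM.
  by apply/funext => x /=; rewrite /re_fun /im_fun; case: (p x) (q x) => a b [? ?] /=; ring.
have [mA mB] := mre _ _ f1 f2 g1 g2.
have [mC mD] := mre _ _ f1' f2' g1' g2'.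
congr (fine _ +i* fine _); apply: ae_eq_integral => //;
  by apply: filterS fg => x /= -> .
Qed.

Lemma cLfun_meas p f : cLfun mu p f -> cmeasurable f. Proof. by case. Qed.

Lemma L2_cLfun (f : L2 mu) : cLfun mu 2%:E f.
Proof. exact: set_mem (valP (repr f)). Qed.

Lemma toL2_ae f : cLfun mu 2%:E f -> {ae mu, forall x, toL2 mu f x = f x}.
Proof.
move=> hf; pose y : L2fun mu := insubd (L2fun0 mu) f.
have yE : L2fun_val y = f by rewrite /L2fun_val /y insubdK//; exact: mem_set.
have /eqmodP/asboolP : (repr (\pi_(L2 mu)%qT y) = y %[mod L2 mu])%qT by rewrite reprK.
rewrite -[toL2 mu f]/(\pi_(L2 mu)%qT y).
by apply: filterS => x; rewrite -yE.
Qed.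

Lemma L2_eq (f g : L2 mu) : {ae mu, forall x, f x = g x} -> f = g.
Proof.
move=> fg; rewrite -[f]reprK -[g]reprK; apply/eqmodP; exact/asboolP.
Qed.

Lemma innerE (f g : L2 mu) : inner f g = cdot f g.
Proof. by []. Qed.

Lemma inner_toL2l f (g : L2 mu) : cLfun mu 2%:E f -> inner (toL2 mu f) g = cdot f g.
Proof.
move=> hf; apply: cdot_ae; rewrite ?(cLfun_meas (L2_cLfun _))//.
- exact: cLfun_meas (L2_cLfun _).
- exact: cLfun_meas (L2_cLfun _).
- exact: cLfun_meas hf.
- exact: cLfun_meas (L2_cLfun _).
- by apply: filterS (toL2_ae hf) => x ->.
Qed.

Lemma inner_toL2r (f : L2 mu) g : cLfun mu 2%:E g -> inner f (toL2 mu g) = cdot f g.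
Proof.
move=> hg; apply: cdot_ae.
- exact: cLfun_meas (L2_cLfun _).
- exact: cLfun_meas (L2_cLfun _).
- exact: cLfun_meas (L2_cLfun _).
- exact: cLfun_meas hg.
- by apply: filterS (toL2_ae hg) => x ->.
Qed.

Lemma inner_conj (f g : L2 mu) : inner f g = conjc (inner g f).
Proof.
rewrite !innerE !cdotE; try exact: L2_cLfun.
rewrite /= !(rdotC mu (re_fun g)) !(rdotC mu (im_fun g)); congr (_ +i* _).
by rewrite opprB.
Qed.

(** Test against the difference [h] of the two vectors: the real part of the
resulting equation says that the squared norm of [h] vanishes. *)
Lemma inner_inj (f f' : L2 mu) : (forall g : L2 mu, inner f g = inner f' g) -> f = f'.
Proof.
move=> ff'.
have /cLfun2P[rf imf] := L2_cLfun f.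
have /cLfun2P[rf' imf'] := L2_cLfun f'.
pose h x := f x - f' x.
have rhE : re_fun h = re_fun f \- re_fun f'.
  by apply/funext => x; rewrite /re_fun /h /=; case: (f x) (f' x) => a b [].
have ihE : im_fun h = im_fun f \- im_fun f'.
  by apply/funext => x; rewrite /im_fun /h /=; case: (f x) (f' x) => a b [].
have rh : re_fun h \in Lfun mu 2%:E by rewrite rhE; exact: Lfun2B.
have ih : im_fun h \in Lfun mu 2%:E by rewrite ihE; exact: Lfun2B.
have hh : cLfun mu 2%:E h by apply/cLfun2P.
have := ff' (toL2 mu h); rewrite !inner_toL2r// !cdotE//; try exact: L2_cLfun.
move=> [E _].
have : rdot mu (re_fun h) (re_fun h) + rdot mu (im_fun h) (im_fun h) = 0.
  by rewrite {1}rhE {1}ihE !rdotBl// addrACA -opprD E subrr.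
move/eqP; rewrite paddr_eq0 ?rdot_sq_ge0// => /andP[/eqP r0 /eqP i0].
apply: L2_eq; apply: filterS2 (rdot_sq_eq0 rh r0) (rdot_sq_eq0 ih i0) => x.
rewrite /re_fun /im_fun /h; case: (f x) (f' x) => a b [a' b'] /= /eqP + /eqP.
by rewrite !subr_eq0 => /eqP -> /eqP ->.
Qed.

Lemma is_adjoint_sym (A B : L2 mu -> L2 mu) : is_adjoint A B -> is_adjoint B A.
Proof. by move=> AB f g; rewrite inner_conj -AB -inner_conj. Qed.

Lemma adjoint_eq (A B : L2 mu -> L2 mu) : is_adjoint A B -> adjoint A = B.
Proof.
move=> AB; apply: xget_unique => // B' AB'; apply/funext => g.
by apply: inner_inj => f; rewrite (is_adjoint_sym AB') (is_adjoint_sym AB).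
Qed.

End complexL2.

(** * Multiplication and composition operators *)

Section operators.
Context d (T : measurableType d) (R : realType).

Lemma comp_bounded_sq (mu : {measure set T -> \bar R}) (phi : T -> T) :
  measurable_fun setT phi -> comp_bounded mu phi ->
  exists2 c : R, 0 < c & sq_comp_bounded mu phi c.
Proof.
move=> mphi [K Kb]; pose K' := Num.max K 1.
have K'0 : 0 < K' by rewrite lt_max ltr01 orbT.
(* The operator bound may be nonpositive, hence the maximum with 1. *)
exists (K' ^+ 2); first by rewrite exprn_gt0.
move=> f hf; pose F : T -> R[i] := fun x => (f x)%:C.
have mf := Lfun2_meas hf.
have mF : cmeasurable F by split => //; exact: measurable_cst.
have mFphi : cmeasurable (F \o phi).
  by split; [exact: measurableT_comp|exact: measurable_cst].
have hF : cLfun mu 2%:E F.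
  apply/cLfun2P; split => //; apply/Lfun2P; split; first exact: measurable_cst.
  by rewrite integral0_eq// => x _; rewrite expr0n.
have nF (G : T -> R) : cmeasurable (fun x => (G x)%:C) ->
    (cnorm mu 2%:E (fun x => (G x)%:C) `^ 2 = \int[mu]_x (G x ^+ 2)%:E)%E.
  by move=> mG; rewrite sqr_cnorm2// [X in (_ + X)%E]integral0_eq ?adde0// => x _; rewrite /im_fun /= expr0n.
rewrite -(nF f)// -[X in (X <= _)%E](nF (f \o phi) mFphi).
have N0 G : (0 <= cnorm mu 2%:E G)%E by exact: Lnorm_ge0.
have -> : ((K' ^+ 2)%:E = K'%:E `^ 2)%E.
  by rewrite poweR_EFin powR_mulrn// ltW.
rewrite -poweRM//; last by rewrite lee_fin ltW.
rewrite gt0_ler_poweR// ?in_itv/= ?leey ?andbT//.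
  by rewrite mule_ge0// lee_fin ltW.
apply: le_trans (Kb _ hF) _; apply: lee_wpmul2r => //.
by rewrite lee_fin le_max lexx.
Qed.

Lemma cLfun_comp (mu : {measure set T -> \bar R}) (phi : T -> T) f :
  nonsingular mu phi -> comp_bounded mu phi -> cLfun mu 2%:E f ->
  cLfun mu 2%:E (f \o phi).
Proof.
move=> [mphi _] [K Kb] hf; split.
  by split; [exact: (measurableT_comp hf.1.1 mphi)|exact: (measurableT_comp hf.1.2 mphi)].
apply: le_lt_trans (Kb _ hf) _.
have N0 : (0 <= cnorm mu 2%:E f)%E by exact: Lnorm_ge0.
have /fineK <- : cnorm mu 2%:E f \is a fin_num by rewrite ge0_fin_numE//; exact: hf.2.
by rewrite -EFinM ltry.
Qed.

Lemma ae_bounded (mu : {measure set T -> \bar R}) (u : T -> R[i]) :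
  cLfun mu +oo%E u -> exists c : R, {ae mu, forall x, cmodulus (u x) <= c}.
Proof.
move=> [_]; rewrite /cnorm unlock; case: ifPn => [_ fin|]; last first.
  (* On a null space the norm is 0 by convention and says nothing about [u]. *)
  rewrite -leNgt => muT _; exists 0.
  exists setT; split => //.
  by apply/eqP; rewrite eq_le muT measure_ge0.
have := ess_sup_ge mu (abse \o (EFin \o cmodulus \o u)).
case: (ess_sup _ _) fin => [r| |] // _ us; [exists r|exists 0];
  apply: filterS us => x /=; rewrite ?leeNy_eq// lee_fin; apply: le_trans.
exact: ler_norm.
Qed.

Lemma cLfun_mult (mu : {measure set T -> \bar R}) (u f : T -> R[i]) :
  cLfun mu +oo%E u -> cLfun mu 2%:E f -> cLfun mu 2%:E (fun x => u x * f x).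
Proof.
move=> hu hf; have [c uc] := ae_bounded hu.
have [[ru iu] _] := hu.
have /cLfun2P[/Lfun2P[mrf frf] /Lfun2P[mif fif]] := hf.
have muf : cmeasurable (fun x => u x * f x).
  split.
    rewrite (_ : (fun _ => _) = (re_fun u \* re_fun f) \- (im_fun u \* im_fun f)).
      by apply: measurable_funB; exact: measurable_funM.
    by apply/funext => x /=; rewrite /re_fun /im_fun; case: (u x) (f x) => a b [].
  rewrite (_ : (fun _ => _) = (re_fun u \* im_fun f) \+ (im_fun u \* re_fun f)).
    by apply: measurable_funD; exact: measurable_funM.
  by apply/funext => x /=; rewrite /re_fun /im_fun; case: (u x) (f x) => a b [].
split => //; apply: (@lty_poweRy _ _ 2) => //.
rewrite sqr_cnorm2// -ge0_integralD//; first last.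
- by apply/measurable_EFinP; apply: measurable_funX; exact: muf.2.
- by move=> x _; rewrite lee_fin sqr_ge0.
- by apply/measurable_EFinP; apply: measurable_funX; exact: muf.1.
- by move=> x _; rewrite lee_fin sqr_ge0.
have msq : measurable_fun setT (fun x => (re_fun f x ^+ 2)%:E + (im_fun f x ^+ 2)%:E)%E.
  by apply: emeasurable_funD; apply/measurable_EFinP; exact: measurable_funX.
apply: (@le_lt_trans _ _ (\int[mu]_x ((c ^+ 2)%:E * ((re_fun f x ^+ 2)%:E + (im_fun f x ^+ 2)%:E)))%E).
  apply: ae_ge0_le_integral => //.
  - by move=> x _; rewrite lee_fin addr_ge0 ?sqr_ge0.
  - by apply: emeasurable_funD; apply/measurable_EFinP; apply: measurable_funX;
      [exact: muf.1|exact: muf.2].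
  - by move=> x _; rewrite lee_fin mulr_ge0 ?addr_ge0 ?sqr_ge0.
  - by apply: emeasurable_funM.
  apply: filterS uc => x + _; rewrite /re_fun /im_fun.
  case: (u x) (f x) => a b [p q] /= uc.
  rewrite -!EFinD -EFinM lee_fin.
  have : a ^+ 2 + b ^+ 2 <= c ^+ 2.
    rewrite -[leLHS]sqr_sqrtr ?addr_ge0 ?sqr_ge0// ler_sqr ?nnegrE ?sqrtr_ge0//.
    exact: le_trans (sqrtr_ge0 _) uc.
  move=> /(ler_wpM2r (addr_ge0 (sqr_ge0 p) (sqr_ge0 q))); apply: le_trans.
  by rewrite le_eqVlt; apply/orP; left; apply/eqP; ring.
rewrite ge0_integralZl//; last first.
- by rewrite lee_fin sqr_ge0.
- by move=> x _; rewrite lee_fin addr_ge0 ?sqr_ge0.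
rewrite lte_mul_pinfty ?lee_fin ?sqr_ge0// ge0_integralD//.
- exact: lte_add_pinfty.
- by move=> x _; rewrite lee_fin sqr_ge0.
- by apply/measurable_EFinP; exact: measurable_funX.
- by move=> x _; rewrite lee_fin sqr_ge0.
- by apply/measurable_EFinP; exact: measurable_funX.
Qed.

(** Conjugating [u * g] leaves [u] unchanged almost everywhere, because a
nonnegative complex number is real. *)
Lemma mult_op_sym (mu : {measure set T -> \bar R}) (u : T -> R[i]) :
  cLfun mu +oo%E u -> {ae mu, forall x, 0 <= u x} ->
  is_adjoint (mult_op mu u) (mult_op mu u).
Proof.
move=> hu u0 f g.
have uL2 (h : L2 mu) := cLfun_mult hu (L2_cLfun h).
rewrite inner_toL2l// inner_toL2r//; apply: cdot_ae.
- exact: cLfun_meas (uL2 _).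
- exact: cLfun_meas (L2_cLfun _).
- exact: cLfun_meas (L2_cLfun _).
- exact: cLfun_meas (uL2 _).
apply: filterS u0 => x; case: (u x) => a b; rewrite lecE /= => /andP[/eqP -> _].
by case: (f x) (g x) => p q [p' q'] /=; apply/eqP; rewrite eq_complex /=;
  apply/andP; split; apply/eqP; ring.
Qed.

(** Composition acts separately on real and imaginary parts, so the real transpose
can be applied to each part. *)
Lemma comp_op_adjoint (mu : {sigma_finite_measure set T -> \bar R}) (phi : T -> T) :
  nonsingular mu phi -> comp_bounded mu phi ->
  exists S : L2 mu -> L2 mu, is_adjoint (comp_op mu phi) S.
Proof.
move=> ns phib.
have [c c0 phic] := comp_bounded_sq ns.1 phib.
(* Stated for every function [a] so that choice yields a total map [t]. *)
have tr (a : T -> R) : exists b : T -> R, a \in Lfun mu 2%:E -> b \in Lfun mu 2%:E /\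
    forall h : T -> R, h \in Lfun mu 2%:E -> rdot mu (h \o phi) a = rdot mu h b.
  have [ha|_] := boolP (a \in Lfun mu 2%:E); last by exists a.
  by have [b hb] := comp_transpose ns c0 phic ha; exists b.
have [t tP] := choice tr.
exists (fun g => toL2 mu (fun x => t (re_fun g) x +i* t (im_fun g) x)) => f g.
have /cLfun2P[rf imf] := L2_cLfun f.
have /cLfun2P[rg img] := L2_cLfun g.
have [trg rgE] := tP _ rg; have [tig igE] := tP _ img.
have tL2 : cLfun mu 2%:E (fun x => t (re_fun g) x +i* t (im_fun g) x) by apply/cLfun2P.
have fphi : cLfun mu 2%:E (f \o phi) by apply: cLfun_comp => //; exact: L2_cLfun.
rewrite inner_toL2l// inner_toL2r// !cdotE//; try exact: L2_cLfun.
by congr (_ +i* _); rewrite -!rgE// -!igE.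
Qed.

End operators.

(** * The equivalence *)

Theorem theorem2p1 (R : realType) (d : measure_display) (X : measurableType d)
    (mu : {sigma_finite_measure set X -> \bar R})
    (u : X -> R[i]) (phi : X -> X)
    (u_Linfty : cLfun mu +oo%E u)
    (u_ge0 : {ae mu, forall x, 0 <= u x})
    (phi_nonsingular : nonsingular mu phi)
    (phi_bounded : comp_bounded mu phi) :
  let M : L2 mu -> L2 mu := mult_op mu u in
  let C : L2 mu -> L2 mu := comp_op mu phi in
  let W : L2 mu -> L2 mu := M \o C in
  (selfadjoint_wrt M C <-> M \o C = adjoint C \o M) /\
  (M \o C = adjoint C \o M <-> adjoint W = W).
Proof.
move=> M C W.
have [S CS] := comp_op_adjoint phi_nonsingular phi_bounded.
have MM : is_adjoint M M := mult_op_sym u_Linfty u_ge0.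
have WSM : is_adjoint W (S \o M) by move=> f g; rewrite /= MM CS.
rewrite (adjoint_eq CS) (adjoint_eq WSM) -/W; split; last by split.
split=> [MC|WE f g].
  apply/funext => f; apply: inner_inj => g.
  by rewrite (is_adjoint_sym CS); exact: MC.
by rewrite /inner_wrt -(is_adjoint_sym CS) -[M (C f)]/(W f) WE.
Qed.
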